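(* Let $(\Omega,\mathcal{F})$ and $(\mathsf{Y},\mathcal{F}_Y)$ be standard Borel spaces, let $K$ be a similarity kernel on $\Omega$, let $(X,Y)$ be a random pair with $X$ valued in $\Omega$ and $Y$ valued in $\mathsf{Y}$, with joint law $\mu_{XY}$ and with $\mu_Y$ the law of $Y$. Let $K^{\mathsf{Y},\mu_{XY}}$ be the posterior-induced output kernel of $\mu_{XY}$. Then a measurable version of $K^{\mathsf{Y},\mu_{XY}}$ exists, and it has the following properties: 1. $K^{\mathsf{Y},\mu_{XY}}$ is $\mu_{XY}$-admissible; 2. if $L$ is any $\mu_{XY}$-admissible output kernel, then $K^{\mathsf{Y},\mu_{XY}}(y,y')\le L(y,y')$ for $(\mu_Y\otimes\mu_Y)$-a.e. $(y,y')$. Consequently, $K^{\mathsf{Y},\mu_{XY}}$ is the minimal $\mu_{XY}$-admissible output kernel in the $(\mu_Y\otimes\mu_Y)$-a.e. order, hence unique (as such a minimal kernel) up to $(\mu_Y\otimes\mu_Y)$-a.e. equality.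
   Context: A similarity kernel on a measurable space $(\Omega,\mathcal{F})$ is a map $K:\Omega\times\Omega\to[0,1]$ that is $\mathcal{F}\otimes\mathcal{F}$-measurable, symmetric ($K(\omega,\omega')=K(\omega',\omega)$), and satisfies $K(\omega,\omega)=1$ for all $\omega$. An output kernel is a similarity kernel on $(\mathsf{Y},\mathcal{F}_Y)$. Posterior-induced output kernel: let $\{\mu_{X\mid Y=y}\}_{y\in\mathsf{Y}}$ be a regular conditional law of $X$ given $Y$. Then $K^{\mathsf{Y},\mu_{XY}}:\mathsf{Y}\times\mathsf{Y}\to[0,1]$ is defined, up to $(\mu_Y\otimes\mu_Y)$-a.e. equality, by $K^{\mathsf{Y},\mu_{XY}}(y,y')=1$ if $y=y'$, and, if $y\ne y'$, $K^{\mathsf{Y},\mu_{XY}}(y,y')$ is the essential supremum of $(\omega,\omega')\mapsto K(\omega,\omega')$ with respect to $\mu_{X\mid Y=y}\otimes\mu_{X\mid Y=y'}$. Admissibility: let $(X,Y)$ and $(X',Y')$ be independent draws from $\mu_{XY}$. An output kernel $L$ is $\mu_{XY}$-admissible if $L(Y,Y')\ge K(X,X')$ almost surely. The $(\mu_Y\otimes\mu_Y)$-a.e. order: $L_1\preceq L_2$ iff $L_1(y,y')\le L_2(y,y')$ for $(\mu_Y\otimes\mu_Y)$-a.e. $(y,y')$. *)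

(* Defs.v *)
From HB Require Import structures.
From mathcomp Require Import all_boot all_order all_algebra.
From mathcomp Require Import all_classical all_reals all_analysis ess_sup_inf.

Set Implicit Arguments.
Unset Strict Implicit.
Unset Printing Implicit Defensive.

Import Order.TTheory GRing.Theory Num.Theory.
Import numFieldNormedType.Exports.

Local Open Scope classical_set_scope.
Local Open Scope ring_scope.

(* T is standard Borel: its sigma-algebra is the Borel sigma-algebra of a Polish
   (separable, completely metrizable) topology. The topology is that of a
   complete, Hausdorff pseudometric space S carried over to T by a bijection. *)
Definition standard_borel (R : realType) (d : measure_display)
    (T : measurableType d) : Prop :=
  exists (S : completePseudoMetricType R) (f : T -> S),
    [/\ hausdorff_space S,
        exists2 D : set S, countable D & dense D,
        bijective f
      & @measurable d T = preimage_set_system setT f <<s @open S >> ].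

Definition similarity_kernel (R : realType) (d : measure_display)
    (T : measurableType d) (K : T -> T -> R) : Prop :=
  [/\ measurable_fun [set: T * T] (fun p => K p.1 p.2),
      forall x x', 0 <= K x x' <= 1,
      forall x x', K x x' = K x' x
    & forall x, K x x = 1].

Definition pair_rv (d d1 d2 : measure_display) (T : measurableType d)
    (T1 : measurableType d1) (T2 : measurableType d2)
    (X : {mfun T >-> T1}) (Y : {mfun T >-> T2}) : T -> T1 * T2 :=
  fun t => (X t, Y t).

HB.instance Definition _ (d d1 d2 : measure_display) (T : measurableType d)
    (T1 : measurableType d1) (T2 : measurableType d2)
    (X : {mfun T >-> T1}) (Y : {mfun T >-> T2}) :=
  isMeasurableFun.Build _ _ _ _ (pair_rv X Y)
    (measurable_fun_pair (measurable_funPT X) (measurable_funPT Y)).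

Section posterior.
Context (R : realType) (d d1 d2 : measure_display) (T : measurableType d)
  (Omega : measurableType d1) (Ysp : measurableType d2).

Definition joint_law (P : probability T R)
    (X : {RV P >-> Omega}) (Y : {RV P >-> Ysp}) : probability (Omega * Ysp)%type R :=
  distribution P (pair_rv X Y).

Definition regular_conditional_law (P : probability T R)
    (X : {RV P >-> Omega}) (Y : {RV P >-> Ysp})
    (kappa : R.-pker Ysp ~> Omega) : Prop :=
  forall (A : set Omega) (B : set Ysp), measurable A -> measurable B ->
    P (X @^-1` A `&` Y @^-1` B) =
      (\int[distribution P Y]_(y in B) kappa y A)%E.

(* [kappa y] repackaged with its probability structure. *)
Definition kernel_law (kappa : R.-pker Ysp ~> Omega) (y : Ysp) :
  set Omega -> \bar R := kappa y.

HB.instance Definition _ (kappa : R.-pker Ysp ~> Omega) (y : Ysp) :=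
  Measure.on (kernel_law kappa y).

HB.instance Definition _ (kappa : R.-pker Ysp ~> Omega) (y : Ysp) :=
  Measure_isProbability.Build _ _ _ (kernel_law kappa y) (prob_kernel y).

(* The essential supremum lies in [0, 1] when K is a similarity kernel, so
   taking [fine] loses nothing. *)
Definition posterior_kernel (K : Omega -> Omega -> R)
    (kappa : R.-pker Ysp ~> Omega) (y y' : Ysp) : R :=
  if y == y' then 1
  else fine (ess_sup (kernel_law kappa y \x kernel_law kappa y')%E (fun p => (K p.1 p.2)%:E)).

Definition ae_le (muY : probability Ysp R) (L1 L2 : Ysp -> Ysp -> R) : Prop :=
  \forall p \ae (muY \x muY)%E, L1 p.1 p.2 <= L2 p.1 p.2.

Definition ae_equal (muY : probability Ysp R) (L1 L2 : Ysp -> Ysp -> R) : Prop :=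
  \forall p \ae (muY \x muY)%E, L1 p.1 p.2 = L2 p.1 p.2.

Definition posterior_version (muY : probability Ysp R)
    (K : Omega -> Omega -> R) (kappa : R.-pker Ysp ~> Omega)
    (L : Ysp -> Ysp -> R) : Prop :=
  similarity_kernel L /\ ae_equal muY L (posterior_kernel K kappa).

(* Two independent draws z.1 = (X, Y) and z.2 = (X', Y') from mu have joint law
   mu \x mu. *)
Definition admissible (mu : probability (Omega * Ysp)%type R)
    (K : Omega -> Omega -> R) (L : Ysp -> Ysp -> R) : Prop :=
  similarity_kernel L /\
  \forall z \ae (mu \x mu)%E, K z.1.1 z.2.1 <= L z.1.2 z.2.2.

Definition minimal_admissible (mu : probability (Omega * Ysp)%type R)
    (muY : probability Ysp R) (K : Omega -> Omega -> R)
    (L : Ysp -> Ysp -> R) : Prop :=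
  admissible mu K L /\
  forall L' : Ysp -> Ysp -> R, admissible mu K L' -> ae_le muY L L'.

End posterior.

(* Main.v *)
Require Import Defs.
From HB Require Import structures.
From mathcomp Require Import all_boot all_order all_algebra.
From mathcomp Require Import lra.
From mathcomp Require Import all_classical all_reals all_analysis.
From mathcomp Require Import measurable_realfun ess_sup_inf.

Set Implicit Arguments.
Unset Strict Implicit.
Unset Printing Implicit Defensive.

Import Order.TTheory GRing.Theory Num.Theory.
Import numFieldNormedType.Exports.

Local Open Scope classical_set_scope.
Local Open Scope ring_scope.

(** Write [nu] for the law of [Y] and [kappa y] for the conditional law of [X]
given [Y = y].

The order-theoretic part rests on one disintegration.  Two independent draws
of [(X, Y)] are obtained by drawing [(y, y')] from [nu \x nu] and then
[(x, x')] from [kappa y \x kappa y']; hence an event about two draws is null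
exactly when, for almost every [(y, y')], its slice is null under
[kappa y \x kappa y'] ([joint_law2_null]).  Apply this to the event
[L y y' < K x x'], where [L] is an output kernel.  Off the diagonal the slice
is null exactly when [L y y'] is an essential upper bound of [K], that is, when
[L y y'] is at least the essential supremum; on the diagonal the slice is empty
because [L y y = 1].  So [L] is admissible if and only if it dominates the
posterior kernel almost everywhere ([admissibleP]), and everything about
minimality and uniqueness follows formally.  The posterior kernel is itself a
similarity kernel: its sublevel sets are described by the vanishing of a
measurable family of masses, the diagonal of a standard Borel space is
measurable, and symmetry is Tonelli's theorem.

The existence of [kappa] is where the Borel structure of [Omega] matters.  A
standard Borel space is a measurable retract of the space of bit streams
([standard_borel_code]): a point is coded by the list of the balls of a
countable family that contain it, and completeness allows decoding.  It is
therefore enough to condition a random bit stream.  The Radon-Nikodym theorem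
gives, for each finite word [w], a conditional probability [G y w] that the
stream starts with [w]; for almost every [y] these are nonnegative and additive
over the two one-bit extensions of [w].  Cutting the unit interval successively
into pieces of lengths [G y w], and reading off the nested pieces that contain
a uniform number [u], yields a bit stream [split_bits (G y) u] that is jointly
measurable in [(y, u)] and has the required conditional law
([unit_uniform_cylinder]).  Its decoding is a random variable whose law, for
fixed [y], is [kappa y]; being the image of the uniform law it is a probability
for every [y], so that no exceptional set has to be repaired. *)

(** * Bit streams *)

Lemma measurable_preimage d1 d2 (T1 : measurableType d1)
    (T2 : measurableType d2) (f : T1 -> T2) (A : set T2) :
  measurable_fun [set: T1] f -> measurable A -> measurable (f @^-1` A).
Proof. by move=> mf mA; rewrite -[X in measurable X]setTI; exact: mf. Qed.

(** The most recent bit comes first, so that extending a prefix by one bit is a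
cons and both words and prefixes are handled by structural recursion. *)
Fixpoint rprefix (s : nat -> bool) (n : nat) : seq bool :=
  if n is m.+1 then s m :: rprefix s m else [::].

Definition cylinder (w : seq bool) : set (nat -> bool) :=
  [set s | rprefix s (size w) = w].

(** The empty set is added to make the family closed under intersection. *)
Definition cylinders : set (set (nat -> bool)) :=
  [set A | A = set0 \/ exists w, A = cylinder w].

Definition bitstream := g_sigma_algebraType cylinders.

Lemma size_rprefix s n : size (rprefix s n) = n.
Proof. by elim: n => //= n ->. Qed.

Lemma drop_rprefix s m n : drop m (rprefix s (m + n)) = rprefix s n.
Proof. by elim: m => [|m IH]; rewrite ?drop0. Qed.

Lemma cylinders_setI : setI_closed cylinders.
Proof.
(* two cylinders are nested or disjoint *)
have key w v : (size v <= size w)%N -> cylinders (cylinder w `&` cylinder v).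
  move=> vw; have [dw|dw] := pselect (drop (size w - size v) w = v).
    right; exists w; apply/seteqP; split=> [s []//|s sw]; split=> //.
    rewrite /cylinder/= -(drop_rprefix s (size w - size v)) subnK//.
    by rewrite (sw : rprefix s (size w) = w).
  left; apply/seteqP; split=> // s [sw sv]; apply: dw.
  rewrite -{2}(sw : rprefix s (size w) = w) -{2}(subnK vw) drop_rprefix.
  exact: sv.
move=> A B [->|[w ->]] [->|[v ->]]; rewrite ?set0I ?setI0; try by left.
by case: (leqP (size v) (size w)) => [|/ltnW] h; last rewrite setIC; apply: key.
Qed.

Lemma measurable_cylinder w : @measurable _ bitstream (cylinder w).
Proof. by apply: sub_sigma_algebra; right; exists w. Qed.

Lemma measurable_bit i : @measurable _ bitstream [set s : nat -> bool | s i].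
Proof.
rewrite (_ : [set s | _] =
    \bigcup_w (if size w == i then cylinder (true :: w) else set0)).
  apply: countable_bigcupT_measurable => // w.
  by case: ifP => _ //; exact: measurable_cylinder.
apply/seteqP; split=> [s /= si|s [w _]]; last first.
  by case: eqP => // wi; rewrite /cylinder /= wi => -[].
exists (rprefix s i) => //; rewrite size_rprefix eqxx.
by rewrite /cylinder /= size_rprefix si.
Qed.

Lemma measurable_bitstream d (T : measurableType d) (b : T -> bitstream) :
  (forall i, measurable [set t | b t i]) -> measurable_fun [set: T] b.
Proof.
move=> mb.
apply: (@measurability _ _ T bitstream setT b cylinders) => //.
move=> _ [_ [->|[w ->]] <-]; rewrite setTI ?preimage_set0//.
elim: w => [|c w IH].
  by rewrite (_ : _ @^-1` _ = setT) //; apply/seteqP; split.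
rewrite (_ : _ @^-1` _ = (if c then [set t | b t (size w)]
   else ~` [set t | b t (size w)]) `&` b @^-1` cylinder w).
  by apply: measurableI => //; case: (c) => //; exact: measurableC.
apply/seteqP; split=> t; rewrite /cylinder /=.
  by move=> [<- ->]; split=> //; case E : (b t (size w)) => //=; rewrite E.
by case: c => [][bt ->]; congr cons => //=; apply/negP.
Qed.

(** * Coding standard Borel spaces *)

Section standard_borel_code.
Context (R : realType) (d : measure_display) (T : measurableType d).

(** Bit [i] of the code of [x] tells whether [x] lies in the [i]-th ball of a
countable family with centres in a dense sequence and radii [1 / n.+1].  A
stream can be decoded when it selects balls of every radius and the selected
balls meet pairwise: the centres of the selected balls then form a Cauchy
sequence.  The limit may fall just outside the selected balls, hence the
factor 2 in the set of candidates [fit].  Passing through the decoder, instead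
of describing the range of the coder, avoids having to prove that the range is
measurable. *)
Lemma standard_borel_code : standard_borel R T ->
  exists (b : T -> bitstream) (D : bitstream -> T),
    [/\ measurable_fun [set: T] b, measurable_fun [set: bitstream] D
      & cancel b D].
Proof.
case=> S [f [hS [Q cQ dQ] [g fK gK] mT]].
have [q Qq] : exists q : nat -> S, Q `<=` range q.
  have /countable_injP[h hi] := cQ.
  exists (fun n => xget point (Q `&` [set x | h x = n])) => x Qx.
  exists (h x) => //; have : (Q `&` [set z | h z = h x]) x by [].
  by case/(xgetI point) => Qz /hi; apply; rewrite ?inE.
(* i codes the ball of radius r i centred at c i; balls need not be open *)
pose c i : S :=
  if (unpickle i : option (nat * nat)) is Some (_, k) then q k else point.
pose r i : R :=
  (if (unpickle i : option (nat * nat)) is Some (n, _) then n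
   else 0)%N.+1%:R^-1.
have r0 i : 0 < r i by rewrite invr_gt0.
pose U i : set S := (ball (c i) (r i))°.
have Ucov (n : nat) x : exists i, U i x /\ r i = n.+1%:R^-1.
  have e0 : 0 < (n.+1%:R^-1 : R) / 2 by rewrite divr_gt0.
  have [z [xz /Qq[k _ kz]]] : (ball x (n.+1%:R^-1 / 2))° `&` Q !=set0.
    apply: dQ; last exact: open_interior.
    by exists x; exact: nbhsx_ballx.
  exists (pickle (n, k)); rewrite /U /c /r pickleK; split=> //.
  apply/nbhs_ballP; exists (n.+1%:R^-1 / 2) => //= y xy.
  rewrite kz; apply: (ball_splitr _ xy); exact: interior_subset.
pose good : set bitstream :=
  [set s | (forall n, exists i, s i /\ r i = n.+1%:R^-1) /\
  forall i j, s i -> s j -> ball (c i) (r i) `&` ball (c j) (r j) !=set0].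
pose fit (s : bitstream) : set S :=
  [set x | forall i, s i -> ball (c i) (2 * r i) x].
have good_fit s : good s -> fit s !=set0.
  case=> gs1 gs2; have [ix ixP] := choice gs1.
  have cix i n : s i -> ball (c i) (r i + n.+1%:R^-1) (c (ix n)).
    move=> si; have [sx <-] := ixP n; have [z [iz xz]] := gs2 _ _ si sx.
    exact: ball_triangle iz (ball_sym xz).
  have /cauchy_cvg/cvg_ex[l ul] : cauchy (c (ix n) @[n --> \oo]).
    apply: cauchy_exP => e e0.
    have [N _ NP] := near_infty_natSinv_lt (PosNum (divr_gt0 e0 (ltr0Sn R 1))).
    exists (c (ix N)); exists N => // m Nm; have [sN rN] := ixP N.
    apply: le_ball (cix (ix N) m sN); rewrite rN [e]splitr.
    by apply: lerD; apply: ltW; apply: NP => /=.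
  exists l => i si.
  have ri2 : 0 < r i / 2 by rewrite divr_gt0.
  have [N _ NP] := near_infty_natSinv_lt (PosNum ri2).
  have [M _ MP] := (cvg_ballP _ _).1 ul _ ri2.
  have := ball_triangle (cix i (maxn N M) si) (ball_sym (MP _ (leq_maxr N M))).
  apply: le_ball; rewrite -addrA mulrDl mul1r lerD2l [leRHS]splitr lerD2r ltW//.
  by apply: NP => /=; exact: leq_maxl.
pose D s := if pselect (good s) then xget point (fit s) else point.
have DE s : good s -> fit s (D s).
  move=> gs; rewrite /D; case: pselect => // g0.
  by apply: xgetPex; exact: good_fit.
have mgood : measurable good.
  pose disj i := [set j | ~ (ball (c i) (r i) `&` ball (c j) (r j) !=set0)].
  pose bit i := [set s : bitstream | s i].
  rewrite (_ : good =
      (\bigcap_n \bigcup_(i in [set i | r i = n.+1%:R^-1]) bit i) `&`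
      (\bigcap_(i in setT) \bigcap_(j in disj i) ~` (bit i `&` bit j))).
    apply: measurableI.
      apply: bigcapT_measurable => n; apply: bigcup_measurable => i _.
      exact: measurable_bit.
    apply: bigcapT_measurable => i; apply: bigcap_measurableType => j _.
    by apply: measurableC; apply: measurableI; exact: measurable_bit.
  apply/seteqP; split=> s [g1 g2]; split.
  - by move=> n _; have [i [si ri]] := g1 n; exists i.
  - by move=> i _ j /= ij [si sj]; apply: ij; exact: g2.
  - by move=> n; have [i ri si] := g1 n I; exists i.
  - by move=> i j si sj; apply: contrapT => ij; apply: (g2 i I j ij).
pose borel := g_sigma_algebraType (@open S).
have mD : measurable_fun [set: bitstream] (D : bitstream -> borel).
  apply: (@measurability _ _ bitstream borel setT D (@open S)) => //.
  move=> _ [V oV <-]; rewrite setTI.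
  (* on decodable streams, D s is in V as soon as a selected doubled ball is *)
  rewrite (_ : _ @^-1` _ =
      (good `&` \bigcup_(i in [set i | ball (c i) (2 * r i) `<=` V])
         [set s : bitstream | s i]) `|` (~` good `&` [set s | V point])).
    apply: measurableU; apply: measurableI => //.
    - by apply: bigcup_measurable => i _; exact: measurable_bit.
    - exact: measurableC.
    - have [Vp|Vp] := pselect (V point).
        by rewrite (_ : [set _ | _] = setT)//; apply/seteqP; split.
      by rewrite (_ : [set _ | _] = set0)//; apply/seteqP; split.
  apply/seteqP; split=> s /=.
    have [gs|gs] := pselect (good s); last first.
      by rewrite /D; case: pselect => // ?; right.
    move=> VD; left; split=> //.
    have /nbhs_ballP[e/= e0 eV] : nbhs (D s) V by exact: open_nbhs_nbhs.
    (* two points of the doubled ball are within 4 radii of each other *)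
    have e4 : 0 < e / 4 by rewrite divr_gt0.
    have [N _ NP] := near_infty_natSinv_lt (PosNum e4).
    have [i [si ri]] := gs.1 N; exists i => //= y iy; apply: eV.
    apply: le_ball (ball_triangle (ball_sym (DE _ gs _ si)) iy).
    have : N.+1%:R^-1 < e / 4 := NP N (leqnn N).
    by rewrite ri; set a := _^-1; lra.
  case=> [[gs [i iV si]]|[gs Vp]].
    by apply: iV; exact: DE.
  by rewrite /D; case: pselect.
exists (fun t i => `[< U i (f t) >]), (g \o D); split.
- apply: measurable_bitstream => i.
  rewrite mT; exists (U i).
    by apply: sub_sigma_algebra; exact: open_interior.
  by rewrite setTI; apply/seteqP; split=> t /asboolP.
- move=> _ A; rewrite mT => -[B sB <-]; rewrite !setTI.
  rewrite (_ : _ @^-1` _ = D @^-1` B).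
    exact: (measurable_preimage mD).
  by apply/seteqP; split=> s /=; rewrite gK.
- move=> t /=; rewrite -[RHS]fK; congr g.
  set s := (fun i => _); have gs : good s.
    split=> [n|i j /asboolP Ui /asboolP Uj].
      by have [i [Ui ri]] := Ucov n (f t); exists i; split=> //; apply/asboolP.
    by exists (f t); split; exact: interior_subset.
  apply: hS; rewrite -closeEnbhs ball_close => e.
  (* 2 radii from D s to the centre and 1 from the centre to f t *)
  have e4 : 0 < e%:num / 3 by rewrite divr_gt0.
  have [N _ NP] := near_infty_natSinv_lt (PosNum e4).
  have [i [Ui ri]] := Ucov N (f t).
  have si : s i by apply/asboolP.
  apply: le_ball (ball_triangle (ball_sym (DE _ gs _ si)) (interior_subset Ui)).
  have : N.+1%:R^-1 < e%:num / 3 := NP N (leqnn N).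
    by rewrite ri; set a := _^-1; lra.
Qed.

(** Countably many measurable bits separate the points. *)
Lemma measurable_diagonal :
  standard_borel R T -> measurable [set p : T * T | p.1 = p.2].
Proof.
move=> /standard_borel_code[b [D [mb _ bK]]].
have mbit i : measurable [set t | b t i].
  by have := mb measurableT _ (measurable_bit i); rewrite setTI.
pose E1 i := (@fst T T) @^-1` [set t | b t i].
pose E2 i := (@snd T T) @^-1` [set t | b t i].
rewrite (_ : [set p | _] =
    \bigcap_i ((E1 i `&` E2 i) `|` (~` E1 i `&` ~` E2 i))).
  apply: bigcapT_measurable => i.
  have m1 : measurable (E1 i) by exact: measurable_preimage.
  have m2 : measurable (E2 i) by exact: measurable_preimage.
  by apply: measurableU; apply: measurableI => //; exact: measurableC.
apply/seteqP; split=> [[x y] /= -> i _|[x y] /= xy].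
  by have [byi|byi] := pselect (b y i); [left|right].
apply: (can_inj bK); apply/funext => i.
have := xy i I; rewrite /E1 /E2 /=.
by case: (b x i); case: (b y i) => //; case=> -[].
Qed.

End standard_borel_code.

(** * Random bit streams with prescribed word probabilities *)

Section interval_splitting.
Context (R : realType).

(** [G w] is meant as the probability that a stream starts with [w].  The word
[w] is given the interval of length [G w] with this left end; the piece of
[false :: w] is put to the left of that of [true :: w]. *)
Fixpoint left_end (G : seq bool -> R) (w : seq bool) : R :=
  if w is c :: v then left_end G v + (if c then G (false :: v) else 0) else 0.

(** At each step [u] is compared with the point that cuts the interval of the
current word into the pieces of its two extensions. *)
Fixpoint descent (G : seq bool -> R) (u : R) (n : nat) : seq bool :=
  if n is m.+1 then
    let w := descent G u m in (left_end G w + G (false :: w) <= u) :: w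
  else [::].

Definition split_bits (G : seq bool -> R) (u : R) : bitstream := fun n =>
  let w := descent G u n in left_end G w + G (false :: w) <= u.

Lemma rprefix_split_bits G u n : rprefix (split_bits G u) n = descent G u n.
Proof. by elim: n => //= n ->. Qed.

Definition word_mass (G : seq bool -> R) : Prop :=
  [/\ forall w, 0 <= G w, G [::] = 1
    & forall w, G w = G (true :: w) + G (false :: w)].

Lemma left_end_bounds G w : word_mass G ->
  0 <= left_end G w /\ left_end G w + G w <= 1.
Proof.
case=> G0 G1 GS; elim: w => [|[] w [IH0 IH1]] /=; first by rewrite G1; lra.
- by have := GS w; have := G0 (false :: w); have := G0 (true :: w); lra.
- by have := GS w; have := G0 (false :: w); have := G0 (true :: w); lra.
Qed.

(** By induction on [w]: additivity of [G] says that the intervals of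
[true :: w] and [false :: w] tile the interval of [w]. *)
Lemma cylinder_split_bits G u w : word_mass G -> 0 <= u < 1 ->
  cylinder w (split_bits G u) <-> left_end G w <= u < left_end G w + G w.
Proof.
move=> [G0 G1 GS] u01; rewrite /cylinder /=.
elim: w => [|c w IH] /=; first by rewrite G1 add0r u01; split.
move: IH; rewrite !rprefix_split_bits /= => IH.
have Gw := GS w; have Gf := G0 (false :: w); have Gt := G0 (true :: w).
split.
  case=> <- dw; move/IH : (dw); rewrite /split_bits dw.
  by case: ifP; lra.
move=> uc; have dw : descent G u (size w) = w.
  by apply/IH; case: (c) uc; lra.
rewrite /split_bits dw; congr cons; case: (c) uc; first lra.
by move=> ?; apply/negbTE; rewrite -ltNge; lra.
Qed.

Definition unit_uniform : set (measurableTypeR R) -> \bar R :=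
  mrestr lebesgue_measure (measurable_itv `[0%R, 1%R[).

HB.instance Definition _ := Measure.on unit_uniform.

Lemma unit_uniformT : unit_uniform [set: _] = 1%E.
Proof.
rewrite /unit_uniform /mrestr setTI.
by rewrite lebesgue_measure_itv/= lte_fin ltr01 sube0.
Qed.

HB.instance Definition _ :=
  Measure_isProbability.Build _ _ _ unit_uniform unit_uniformT.

Lemma unit_uniform_cylinder G w : word_mass G ->
  unit_uniform [set u | cylinder w (split_bits G u)] = (G w)%:E.
Proof.
move=> mG; have [G0 _ _] := mG; have [l0 l1] := left_end_bounds w mG.
rewrite /unit_uniform /mrestr.
rewrite (_ : _ `&` _ = [set` `[left_end G w, left_end G w + G w[]).
  rewrite lebesgue_measure_itv/= lte_fin ltrDl.
  case: ltP => Gw; last by congr EFin; apply/eqP; rewrite eq_le G0 Gw.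
  by rewrite -EFinB addrC addKr.
apply/seteqP; split=> u /=; rewrite !in_itv/=.
  by case=> /cylinder_split_bits; apply.
move=> /[dup] u1 /andP[lu ul].
have u01 : 0 <= u < 1 by rewrite (le_trans l0 lu) (lt_le_trans ul l1).
by split=> //; apply/cylinder_split_bits.
Qed.

Lemma measurable_split_bits d (T : measurableType d) (G : T -> seq bool -> R) :
  (forall w, measurable_fun [set: T] (G^~ w)) ->
  measurable_fun [set: T * measurableTypeR R] (fun p => split_bits (G p.1) p.2).
Proof.
move=> mG.
have ml w : measurable_fun [set: T] (fun y => left_end (G y) w).
  elim: w => [|c w IH] /=; first exact: measurable_cst.
  by apply: measurable_funD => //; case: (c); [exact: mG|exact: measurable_cst].
pose B w := [set p : T * measurableTypeR R |
  left_end (G p.1) w + G p.1 (false :: w) <= p.2].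
have mB w : measurable (B w).
  have mf (g : T -> R) : measurable_fun setT g ->
      measurable_fun [set: T * measurableTypeR R] (g \o fst).
    by move=> mg'; exact: measurableT_comp.
  have : measurable_fun [set: T * measurableTypeR R]
      (fun p => left_end (G p.1) w + G p.1 (false :: w) <= p.2).
    apply: measurable_fun_ler => //.
    by apply: measurable_funD; [exact: mf (ml w)|exact: mf (mG _)].
  by move=> /(_ measurableT [set true] I); rewrite setTI.
have mW n w : measurable [set p : T * measurableTypeR R |
    descent (G p.1) p.2 n = w].
  elim: n w => [|n IH] [|c w] /=.
  - by rewrite (_ : [set _ | _] = setT)//; apply/seteqP; split.
  - by rewrite (_ : [set _ | _] = set0)//; apply/seteqP; split.
  - by rewrite (_ : [set _ | _] = set0)//; apply/seteqP; split.
  rewrite (_ : [set _ | _] =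
      (if c then B w else ~` B w) `&` [set p | descent (G p.1) p.2 n = w]).
    by apply: measurableI => //; case: (c) => //; exact: measurableC.
  apply/seteqP; split=> p /=.
    by case=> <- ->; split=> //; case: ifP; rewrite /B/= => // ->.
  by case: c => -[Bp ->]; congr cons => //; apply/negP.
apply: measurable_bitstream => n.
rewrite (_ : [set _ | _] =
    \bigcup_w ([set p | descent (G p.1) p.2 n = w] `&` B w)).
  by apply: countable_bigcupT_measurable => // w; exact: measurableI.
apply/seteqP; split=> p; first by exists (descent (G p.1) p.2 n).
by case=> w _ [/= <-].
Qed.

End interval_splitting.

(** * Conditional probabilities *)

Section mixture.
Context d1 d2 (Y : measurableType d1) (Z : measurableType d2) (R : realType).
Variables (m : {measure set Y -> \bar R}) (k : Y -> {measure set Z -> \bar R}).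
Hypothesis mk : forall U, measurable U -> measurable_fun [set: Y] (k ^~ U).

Definition mixture
    of (forall U, measurable U -> measurable_fun [set: Y] (k ^~ U)) :=
  fun U : set Z => (\int[m]_y k y U)%E.

Local Notation mix := (mixture mk).

Let mix0 : mix set0 = 0%E.
Proof. by apply: integral0_eq => y _; rewrite measure0. Qed.

Let mix_ge0 U : (0 <= mix U)%E. Proof. exact: integral_ge0. Qed.

Let mix_sigma_additive : semi_sigma_additive mix.
Proof.
move=> U mU tU mUU; rewrite [X in _ --> X](_ : _ =
    (\int[m]_y (\sum_(n <oo) k y (U n)))%E); last first.
  apply: eq_integral => y _.
  by apply/esym/cvg_lim => //; exact/measure_semi_sigma_additive.
apply/cvg_closeP; split.
  by apply: is_cvg_nneseries => n _ _; exact: integral_ge0.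
by rewrite closeE// integral_nneseries// => n; exact: mk.
Qed.

HB.instance Definition _ :=
  isMeasure.Build _ _ _ mix mix0 mix_ge0 mix_sigma_additive.

End mixture.

Section joint_event.
Context d1 d2 (T : measurableType d1) (Y : measurableType d2) (R : realType).
Variables (P : probability T R) (Yv : {RV P >-> Y}) (F : set T).
Hypothesis mF : measurable F.

Definition event_law of measurable F :=
  fun B : set Y => P (F `&` Yv @^-1` B).

Local Notation nu := (event_law mF).

Let mpre B : measurable B -> measurable (Yv @^-1` B).
Proof. by move=> mB; exact: measurable_preimage. Qed.

Let nu0 : nu set0 = 0%E. Proof. by rewrite /event_law preimage_set0 setI0. Qed.

Let nu_ge0 B : (0 <= nu B)%E. Proof. exact: measure_ge0. Qed.

Let nu_sigma_additive : semi_sigma_additive nu.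
Proof.
move=> B mB tB mBB; rewrite /event_law preimage_bigcup setI_bigcupr.
apply: measure_semi_sigma_additive.
- by move=> n; apply: measurableI => //; exact: mpre.
- apply: trivIset_setIl; apply/trivIsetP => i j _ _ ij; rewrite -preimage_setI.
  by move/trivIsetP : tB => /(_ _ _ I I ij) ->; rewrite preimage_set0.
- rewrite -setI_bigcupr -preimage_bigcup; apply: measurableI => //.
  exact: mpre.
Qed.

HB.instance Definition _ :=
  isMeasure.Build _ _ _ nu nu0 nu_ge0 nu_sigma_additive.

Let nu_fin : fin_num_fun nu.
Proof.
move=> B mB; rewrite ge0_fin_numE//.
apply: le_lt_trans (probability_le1 P _) (ltry _).
by apply: measurableI => //; exact: mpre.
Qed.

HB.instance Definition _ := Measure_isFinite.Build _ _ _ nu nu_fin.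

(** Radon-Nikodym: an event of [Yv] that has probability zero still has
probability zero after intersection with [F]. *)
Lemma conditional_density : exists g : Y -> R,
  [/\ measurable_fun [set: Y] g, forall y, 0 <= g y
    & forall B, measurable B ->
        P (F `&` Yv @^-1` B) = (\int[distribution P Yv]_(y in B) (g y)%:E)%E].
Proof.
have [|f [f0 ffin fint fE]] := @radon_nikodym_sigma_finite _ _ _
    (distribution P Yv) (event_law mF).
  move=> B B0 A mA AB; apply/eqP; rewrite -measure_le0 -(B0 A mA AB).
  apply: le_measure; rewrite ?inE; [|exact: mpre|exact: subIsetr].
  by apply: measurableI => //; exact: mpre.
exists (fine \o f); split.
- by apply: measurableT_comp => //; exact: measurable_int fint.
- by move=> y /=; exact: fine_ge0.
- move=> B mB; rewrite -[LHS]/(event_law mF B) fE//.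
  by apply: eq_integral => y _; rewrite /= fineK.
Qed.

End joint_event.

(** Images of one fixed law: every member of the family is a probability, and
joint measurability of [phi] gives measurability in [y]. *)
Section noise_kernel.
Context d1 d2 (Y : measurableType d1) (Z : measurableType d2) (R : realType).
Variable phi : Y * measurableTypeR R -> Z.
Hypothesis mphi : measurable_fun [set: Y * measurableTypeR R] phi.

Definition noise_map of measurable_fun [set: Y * measurableTypeR R] phi :=
  fun (y : Y) (u : measurableTypeR R) => phi (y, u).

HB.instance Definition _ y := isMeasurableFun.Build _ _ _ _ (noise_map mphi y)
  (measurable_fun_pair2 y mphi).

Definition noise_kernel : Y -> {measure set Z -> \bar R} :=
  fun y => distribution (@unit_uniform R) (noise_map mphi y).

Let noise_kernel_measurable U : measurable U ->
  measurable_fun [set: Y] (noise_kernel ^~ U).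
Proof.
move=> mU.
have mS : measurable (phi @^-1` U) by exact: measurable_preimage.
rewrite (_ : (fun y => _) = (@unit_uniform R) \o xsection (phi @^-1` U)).
  exact: measurable_fun_xsection.
apply/funext => y /=; rewrite /noise_kernel /distribution /pushforward.
congr unit_uniform.
by apply/seteqP; split=> u /=; rewrite /xsection /= inE.
Qed.

HB.instance Definition _ := isKernel.Build _ _ _ _ _ noise_kernel
  noise_kernel_measurable.

Let noise_kernel_prob y : noise_kernel y [set: Z] = 1%E.
Proof. exact: probability_setT. Qed.

HB.instance Definition _ := Kernel_isProbability.Build _ _ _ _ _ noise_kernel
  noise_kernel_prob.

End noise_kernel.

Section word_densities.
Context d1 d2 (T : measurableType d1) (Y : measurableType d2) (R : realType).
Variables (P : probability T R) (Yv : {RV P >-> Y}) (B : {RV P >-> bitstream}).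

Let mBw w : measurable (B @^-1` cylinder w).
Proof.
by apply: measurable_preimage => //; exact: measurable_cylinder.
Qed.

(** Each of the countably many additivity identities holds almost everywhere
because both sides have the same integral over every event of [Yv]. *)
Lemma word_densities : exists G : Y -> seq bool -> R,
  [/\ forall w, measurable_fun [set: Y] (G^~ w),
      forall w A, measurable A -> P (B @^-1` cylinder w `&` Yv @^-1` A) =
        (\int[distribution P Yv]_(y in A) (G y w)%:E)%E
    & \forall y \ae distribution P Yv, word_mass (G y)].
Proof.
have [g gP] := choice (fun w => conditional_density Yv (mBw w)).
have mg w : measurable_fun [set: Y] (EFin \o g w).
  by apply/measurable_EFinP; case: (gP w).
have ig w : (distribution P Yv).-integrable setT (EFin \o g w).
  apply/integrableP; split=> //.
  have [_ g0 gE] := gP w.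
  under eq_integral do rewrite gee0_abs ?lee_fin//.
  rewrite -gE// preimage_setT setIT.
  exact: le_lt_trans (probability_le1 P (mBw w)) (ltry _).
exists (fun y w => g w y); split.
- by move=> w; case: (gP w).
- by move=> w A mA; case: (gP w) => _ _ ->.
have g1 : \forall y \ae distribution P Yv, g [::] y = 1.
  have : ae_eq (distribution P Yv) setT (EFin \o g [::]) (cst 1%E).
    apply: integral_ae_eq => // E _ mE.
    have [_ _ <-//] := gP [::].
    rewrite integral_cst// mul1e (_ : _ @^-1` cylinder [::] = setT) ?setTI//.
    by apply/seteqP; split.
  by apply: filterS => y h; have := h I; case.
have gS : \forall y \ae distribution P Yv,
    forall n, let w := odflt [::] (unpickle n) in
      g w y = g (true :: w) y + g (false :: w) y.
  apply/ae_foralln => n; set w := odflt _ _.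
  have : ae_eq (distribution P Yv) setT (EFin \o g w)
      ((EFin \o g (true :: w)) \+ (EFin \o g (false :: w))).
    apply: integral_ae_eq => //; first exact: emeasurable_funD.
    move=> E _ mE; have [_ _ <-//] := gP w.
    have g0 v y : (0 <= (g v y)%:E)%E by rewrite lee_fin; case: (gP v).
    rewrite ge0_integralD//=; [|exact: measurable_funTS..].
    have [_ _ <-//] := gP (true :: w); have [_ _ <-//] := gP (false :: w).
    have mY : measurable (Yv @^-1` E) by exact: measurable_preimage.
    rewrite -measureU; [|exact: measurableI|exact: measurableI|].
      congr (P _); rewrite -setIUl; congr (_ `&` _).
      apply/seteqP; split=> t; rewrite /cylinder/=; last by case=> -[].
      by case: (B t (size w)) => ->; [left|right].
    apply/seteqP; split=> // t; rewrite /cylinder /=.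
    by move=> [[[-> _] _] [[]]].
  by apply: filterS => y h; have := h I; case.
apply: filterS2 g1 gS => y gy1 gyS; split=> // w; first by case: (gP w).
by have := gyS (pickle w); rewrite pickleK.
Qed.

(** The two sides, as measures in [C] for fixed [A], agree on cylinders: the
cylinder of [w] has mass [G y w] under [split_bits (G y)] for almost every
[y]. *)
Lemma conditional_law_bits : exists2 psi : Y * measurableTypeR R -> bitstream,
  measurable_fun setT psi &
  forall C A, measurable C -> measurable A -> P (B @^-1` C `&` Yv @^-1` A) =
    (\int[distribution P Yv]_(y in A) unit_uniform [set u | C (psi (y, u))])%E.
Proof.
have [G [mG GE Gae]] := word_densities.
have mpsi := measurable_split_bits mG.
exists (fun p => split_bits (G p.1) p.2) => // C A mC mA.
(* vanishing outside A turns the integral over A into a mixture over Y *)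
pose k y : {measure set bitstream -> \bar R} :=
  if y \in A then noise_kernel mpsi y else mzero.
have kE U : k ^~ U = ((noise_kernel mpsi) ^~ U) \_ A.
  by apply/funext => y; rewrite patchE /k; case: ifPn.
have mk U : measurable U -> measurable_fun setT (k ^~ U).
  move=> mU; rewrite kE; apply/(measurable_restrictT _ mA).
  exact/measurable_funTS/measurable_kernel.
have mYA : measurable (Yv @^-1` A) by exact: measurable_preimage.
have mixE U : mixture (distribution P Yv) mk U =
    (\int[distribution P Yv]_(y in A) noise_kernel mpsi y U)%E.
  rewrite /mixture [RHS]integral_mkcond.
  by apply: eq_integral => y _; rewrite -kE.
rewrite setIC -[LHS]/(event_law B mYA C) -[RHS]mixE.
have cylT : cylinders setT.
  by right; exists [::]; apply/seteqP; split.
apply: (@measure_unique _ R bitstream cylinders (fun=> setT) erefl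
  cylinders_setI (fun=> cylT) _ (event_law B mYA)
  (mixture (distribution P Yv) mk)) => //.
- by rewrite bigcup_const.
- move=> _ [->|[w ->]]; first by rewrite !measure0.
  transitivity (P (B @^-1` cylinder w `&` Yv @^-1` A)); first by rewrite setIC.
  rewrite GE// [RHS]mixE; apply: ae_eq_integral => //.
  + exact/measurable_funTS/measurable_EFinP.
  + by apply/measurable_funTS/measurable_kernel; exact: measurable_cylinder.
  + by apply: filterS Gae => y my _; rewrite -(unit_uniform_cylinder w my).
- move=> _; apply: le_lt_trans (probability_le1 P _) (ltry _).
  by rewrite preimage_setT setIT.
Qed.
End word_densities.

Section regular_conditional_law_exists.
Context (R : realType) (d d1 d2 : measure_display) (T : measurableType d)
  (Omega : measurableType d1) (Ysp : measurableType d2).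

(** Condition the code of [X] and decode: as decoding is a left inverse of
coding, [X] lies in [A] exactly when its code decodes into [A]. *)
Lemma regular_conditional_law_exists (P : probability T R)
    (X : {RV P >-> Omega}) (Y : {RV P >-> Ysp}) :
  standard_borel R Omega ->
  exists kappa : R.-pker Ysp ~> Omega, regular_conditional_law X Y kappa.
Proof.
move=> /standard_borel_code[b [D [mb mD bK]]].
have mbX : measurable_fun setT (b \o X) by exact: measurableT_comp.
pose B : {mfun T >-> bitstream} := mfun_Sub (mem_set mbX).
have [psi mpsi psiE] := conditional_law_bits Y B.
have mphi : measurable_fun setT (D \o psi) by exact: measurableT_comp.
exists (noise_kernel mphi) => A C mA mC.
have mDA : measurable (D @^-1` A) by exact: measurable_preimage.
transitivity (P (B @^-1` (D @^-1` A) `&` Y @^-1` C)); last exact: psiE.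
by congr (P (_ `&` _)); apply/seteqP; split=> t /=; rewrite bK.
Qed.
End regular_conditional_law_exists.

(** * Disintegration of two independent draws *)

Section kernel_generator.
Context d1 d2 (Y : measurableType d1) (Z : measurableType d2) (R : realType).

(** Dynkin's lemma; the masses being probabilities is what makes the family of
good sets stable under complement. *)
Lemma measurable_kernel_generator (k : Y -> probability Z R) (G : set (set Z)) :
  @measurable _ Z = <<s G >> -> setI_closed G ->
  (forall A, G A -> measurable_fun [set: Y] (k ^~ A)) ->
  forall A, measurable A -> measurable_fun [set: Y] (k ^~ A).
Proof.
move=> mG GI Gk A; rewrite mG; move: A.
apply: dynkin_induction => //.
- rewrite (_ : (fun y => _) = cst 1%E)//.
  by apply/funext => y; exact: probability_setT.
- move=> S mS mk; under eq_fun do rewrite probability_setC//.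
  exact: emeasurable_funB.
- move=> F mF tF mk.
  rewrite (_ : (fun y => _) = fun y => (\sum_(0 <= n <oo) k y (F n))%E).
    by apply: ge0_emeasurable_sum.
  apply/funext => y; apply/esym/cvg_lim => //.
  by apply: measure_semi_sigma_additive => //; exact: bigcup_measurable.
Qed.

Lemma rectangles_setI :
  setI_closed [set A `*` B | A in @measurable _ Y & B in @measurable _ Z].
Proof.
move=> _ _ [A1 mA1 [B1 mB1 <-]] [A2 mA2 [B2 mB2 <-]].
exists (A1 `&` A2); first exact: measurableI.
by exists (B1 `&` B2); [exact: measurableI|rewrite setXI].
Qed.

End kernel_generator.

Section slices.
Context d1 d2 (X : measurableType d1) (Y : measurableType d2).

Definition slice (y : Y) (x : X) : X * Y := (x, y).

HB.instance Definition _ y := isMeasurableFun.Build _ _ _ _ (slice y)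
  (measurable_fun_pair (@measurable_id _ X setT) (measurable_cst y)).

Definition slice2 (p : Y * Y) (q : X * X) : (X * Y) * (X * Y) :=
  ((q.1, p.1), (q.2, p.2)).

Lemma measurable_slice2 p : measurable_fun setT (slice2 p).
Proof.
by apply: measurable_fun_pair; apply: measurable_fun_pair.
Qed.

HB.instance Definition _ p := isMeasurableFun.Build _ _ _ _ (slice2 p)
  (measurable_slice2 p).

End slices.

Section disintegration.
Context (R : realType) (d d1 d2 : measure_display) (T : measurableType d)
  (Omega : measurableType d1) (Ysp : measurableType d2).
Variables (P : probability T R) (X : {RV P >-> Omega}) (Y : {RV P >-> Ysp})
  (kappa : R.-pker Ysp ~> Omega).

(** The law of [(x, y)] for [x] drawn from [kappa y], a measure on the whole
product carried by the fibre over [y]. *)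
Definition fibre_law (y : Ysp) : probability (Omega * Ysp)%type R :=
  distribution (kernel_law kappa y) (slice y).

(** Two independent draws with prescribed second components. *)
Definition fibre_law2 (p : Ysp * Ysp) :
    probability ((Omega * Ysp) * (Omega * Ysp))%type R :=
  distribution (kernel_law kappa p.1 \x kernel_law kappa p.2)%E (slice2 p).

Lemma fibre_law_rectangle y A B :
  fibre_law y (A `*` B) = (kappa y A * (\1_B y)%:E)%E.
Proof.
rewrite /fibre_law /= /distribution /pushforward indicE.
have [yB|yB] := boolP (y \in B).
  rewrite mule1 (_ : slice y @^-1` _ = A)//.
  by apply/seteqP; split=> x; [case|split=> //; exact/set_mem].
rewrite mule0 (_ : slice y @^-1` _ = set0)//.
by apply/seteqP; split=> // x [_] /mem_set; rewrite (negbTE yB).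
Qed.

Lemma measurable_fibre_law E : measurable E ->
  measurable_fun [set: Ysp] (fibre_law ^~ E).
Proof.
apply: measurable_kernel_generator; first exact: measurable_prod_measurableType.
  exact: rectangles_setI.
move=> _ [A mA [B mB <-]].
under eq_fun do rewrite fibre_law_rectangle.
apply: emeasurable_funM; first exact: measurable_kernel.
by apply/measurable_EFinP; exact: measurable_indic.
Qed.

Lemma fibre_law2_rectangle p E1 E2 : measurable E1 -> measurable E2 ->
  fibre_law2 p (E1 `*` E2) = (fibre_law p.1 E1 * fibre_law p.2 E2)%E.
Proof.
move=> mE1 mE2; rewrite /fibre_law2 /fibre_law /= /distribution /pushforward.
rewrite -product_measure1E.
- by congr (_ _); apply/seteqP; split.
- exact: measurable_preimage.
- exact: measurable_preimage.
Qed.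

Lemma measurable_fibre_law2 E : measurable E ->
  measurable_fun [set: Ysp * Ysp] (fibre_law2 ^~ E).
Proof.
apply: measurable_kernel_generator; first exact: measurable_prod_measurableType.
  exact: rectangles_setI.
move=> _ [E1 mE1 [E2 mE2 <-]].
under eq_fun do rewrite fibre_law2_rectangle//.
apply: emeasurable_funM.
- exact: measurableT_comp (measurable_fibre_law mE1)
    (@measurable_fst _ _ Ysp Ysp).
- exact: measurableT_comp (measurable_fibre_law mE2)
    (@measurable_snd _ _ Ysp Ysp).
Qed.

Hypothesis hk : regular_conditional_law X Y kappa.

Lemma joint_law_disintegration E : measurable E ->
  joint_law X Y E = (\int[distribution P Y]_y fibre_law y E)%E.
Proof.
move=> mE; rewrite -[RHS]/(mixture (distribution P Y) measurable_fibre_law E).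
apply: (@measure_unique _ R (Omega * Ysp)%type
  [set A `*` B | A in measurable & B in measurable] (fun=> setT)) => //.
- exact: measurable_prod_measurableType.
- exact: rectangles_setI.
- by move=> _; exists setT => //; exists setT => //; rewrite setXTT.
- by rewrite bigcup_const.
- move=> _ [A mA [B mB <-]].
  transitivity (P (X @^-1` A `&` Y @^-1` B)).
    by congr (P _); apply/seteqP; split.
  rewrite hk// integral_mkcond /mixture; apply: eq_integral => y _.
  rewrite [RHS](fibre_law_rectangle y A B) patchE indicE.
  by case: ifPn; rewrite ?mule1 ?mule0.
- by move=> _; apply: le_lt_trans (probability_le1 (joint_law X Y) _) (ltry _).
Qed.

(** On a rectangle, Tonelli's theorem factors the integral into the two
disintegrations of the joint law; rectangles determine a product measure. *)
Lemma joint_law2_disintegration E : measurable E ->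
  (joint_law X Y \x joint_law X Y)%E E =
    (\int[distribution P Y \x distribution P Y]_p fibre_law2 p E)%E.
Proof.
move=> mE.
rewrite -[RHS]/(mixture (distribution P Y \x distribution P Y)%E
  measurable_fibre_law2 E).
apply: product_measure_unique => // A B mA mB.
transitivity (\int[distribution P Y \x distribution P Y]_p
    (fibre_law p.1 A * fibre_law p.2 B))%E.
  by apply: eq_integral => p _; exact: fibre_law2_rectangle.
rewrite fubini_tonelli1//=; last 2 first.
- apply: emeasurable_funM.
  + exact: measurableT_comp (measurable_fibre_law mA)
      (@measurable_fst _ _ Ysp Ysp).
  + exact: measurableT_comp (measurable_fibre_law mB)
      (@measurable_snd _ _ Ysp Ysp).
- by move=> p; apply: mule_ge0.
transitivity (\int[distribution P Y]_y (fibre_law y A * joint_law X Y B))%E.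
  apply: eq_integral => y _; rewrite /fubini_F /= joint_law_disintegration//.
  by apply: ge0_integralZl => //; exact: measurable_fibre_law.
rewrite (joint_law_disintegration mA).
by apply: ge0_integralZr => //; exact: measurable_fibre_law.
Qed.

Lemma joint_law2_null E : measurable E ->
  (joint_law X Y \x joint_law X Y)%E E = 0%E <->
  \forall p \ae (distribution P Y \x distribution P Y)%E, fibre_law2 p E = 0%E.
Proof.
move=> mE; rewrite joint_law2_disintegration//.
have := @ae_eq_integral_abs _ _ _ (distribution P Y \x distribution P Y)%E _
  measurableT _ (measurable_fibre_law2 mE).
under eq_integral do rewrite gee0_abs//.
by move=> ->; split; apply: filterS => p; [apply|].
Qed.

End disintegration.

(** * The posterior kernel *)

Section product_swap.
Context d1 d2 (X : measurableType d1) (Y : measurableType d2) (R : realType).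

Definition flip (p : X * Y) : Y * X := (p.2, p.1).

HB.instance Definition _ := isMeasurableFun.Build _ _ _ _ flip
  (measurable_fun_pair (@measurable_snd _ _ X Y) (@measurable_fst _ _ X Y)).

Lemma product_measure_flip (m1 : probability X R) (m2 : probability Y R) A :
  measurable A -> (m2 \x m1)%E A = (m1 \x m2)%E (flip @^-1` A).
Proof.
move=> mA; rewrite -[RHS]/(distribution (m1 \x m2)%E flip A).
apply: product_measure_unique => // B C mB mC.
rewrite muleC -product_measure1E//= /distribution /pushforward.
by congr (_ _); apply/seteqP; split=> -[x y] [].
Qed.

End product_swap.

Section posterior_kernel_theory.
Context (R : realType) (d1 d2 : measure_display)
  (Omega : measurableType d1) (Ysp : measurableType d2).
Variables (K : Omega -> Omega -> R) (kappa : R.-pker Ysp ~> Omega).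
Hypothesis hK : similarity_kernel K.

Let mK : measurable_fun setT (fun q : Omega * Omega => K q.1 q.2).
Proof. by case: hK. Qed.

Definition exceedance (c : R) : set (Omega * Omega) := [set q | c < K q.1 q.2].

Lemma measurable_exceedance c : measurable (exceedance c).
Proof.
have : measurable_fun setT (fun q : Omega * Omega => c < K q.1 q.2).
  exact: measurable_fun_ltr.
by move=> /(_ measurableT [set true] I); rewrite setTI.
Qed.

(** The form in which essential suprema are used: it turns a bound on an
essential supremum into a mass, which depends measurably on [(y, y')]. *)
Lemma ess_sup_le_exceedance y y' c :
  (ess_sup (kernel_law kappa y \x kernel_law kappa y')%E
     (fun q => (K q.1 q.2)%:E) <= c%:E)%E <->
  (kernel_law kappa y \x kernel_law kappa y')%E (exceedance c) = 0%E.
Proof.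
have mKE : measurable_fun setT (fun q : Omega * Omega => (K q.1 q.2)%:E).
  exact/measurable_EFinP.
rewrite (_ : exceedance c =
    (fun q : Omega * Omega => (K q.1 q.2)%:E) @^-1` `]c%:E, +oo[).
  split; first by move=> /ess_supP /(ae_le_measureP _ _ mKE).
  by move=> /(ae_le_measureP _ _ mKE) h; exact/ess_supP.
by apply/seteqP; split=> q /=; rewrite in_itv/= andbT lte_fin.
Qed.

Lemma ess_sup_similarity_bounds y y' :
  (0%E <= ess_sup (kernel_law kappa y \x kernel_law kappa y')%E
     (fun q => (K q.1 q.2)%:E) <= 1%:E)%E.
Proof.
case: hK => _ K01 _ _; apply/andP; split.
  apply: ess_sup_gee.
    by rewrite [ltRHS](_ : _ = 1%E)//; exact: probability_setT.
  by apply: aeW => q; rewrite lee_fin; case/andP: (K01 q.1 q.2).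
by apply/ess_supP; apply: aeW => q; rewrite lee_fin; case/andP: (K01 q.1 q.2).
Qed.

Lemma posterior_kernel_le y y' c : y != y' ->
  posterior_kernel K kappa y y' <= c <->
  (kernel_law kappa y \x kernel_law kappa y')%E (exceedance c) = 0%E.
Proof.
move=> /negbTE yy'; rewrite /posterior_kernel yy' -ess_sup_le_exceedance.
rewrite -lee_fin fineK//.
have /andP[e0 e1] := ess_sup_similarity_bounds y y'.
by rewrite ge0_fin_numE// (le_lt_trans e1)// ltry.
Qed.

Lemma posterior_kernel_diag y : posterior_kernel K kappa y y = 1.
Proof. by rewrite /posterior_kernel eqxx. Qed.

Lemma posterior_kernel_bounds y y' : 0 <= posterior_kernel K kappa y y' <= 1.
Proof.
rewrite /posterior_kernel; case: eqP => _; first by rewrite ler01 lexx.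
have /andP[e0 e1] := ess_sup_similarity_bounds y y'.
rewrite fine_ge0//= -lee_fin fineK// ge0_fin_numE//.
by rewrite (le_lt_trans e1)// ltry.
Qed.

Lemma posterior_kernel_sym y y' :
  posterior_kernel K kappa y y' = posterior_kernel K kappa y' y.
Proof.
suff le_sym z z' :
    posterior_kernel K kappa z z' <= posterior_kernel K kappa z' z.
  by apply/le_anti; rewrite !le_sym.
have [->//|zz'] := eqVneq z z'.
apply/(posterior_kernel_le _ zz').
rewrite product_measure_flip; last exact: measurable_exceedance.
set c := posterior_kernel _ _ _ _.
rewrite (_ : _ @^-1` _ = exceedance c).
  by apply/(@posterior_kernel_le z' z); rewrite 1?eq_sym.
by case: hK => _ _ Ks _; apply/seteqP; split=> q; rewrite /exceedance /= Ks.
Qed.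

Lemma measurable_posterior_kernel : standard_borel R Ysp ->
  measurable_fun setT (fun p : Ysp * Ysp => posterior_kernel K kappa p.1 p.2).
Proof.
move=> /measurable_diagonal; set Delta := [set p | _] => mDelta.
apply: (@measurability _ _ _ _ _ _ _ (RGenOInfty.measurableE R)) => //.
move=> _ [_ [r ->] <-]; rewrite setTI.
set U : set ((Omega * Ysp) * (Omega * Ysp)) :=
  [set z | exceedance r (z.1.1, z.2.1)].
have mU : measurable U.
  have mf : measurable_fun setT
      (fun z : (Omega * Ysp) * (Omega * Ysp) => (z.1.1, z.2.1)).
    by apply: measurable_fun_pair; exact: measurableT_comp.
  by apply: (measurable_preimage mf); exact: measurable_exceedance.
have mN : measurable [set p : Ysp * Ysp | fibre_law2 kappa p U = 0%E].
  have := measurable_fibre_law2 kappa mU measurableT (emeasurable_set1 0%E).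
  by rewrite setTI.
rewrite -[X in measurable X]setCK; apply: measurableC.
rewrite (_ : ~` _ = (Delta `&` [set _ | 1 <= r]) `|`
    (~` Delta `&` [set p : Ysp * Ysp | fibre_law2 kappa p U = 0%E])).
  apply: measurableU; apply: measurableI => //; last exact: measurableC.
  have [r1|r1] := boolP (1 <= r).
    by rewrite (_ : [set _ | _] = setT)//; apply/seteqP; split.
  by rewrite (_ : [set _ | _] = set0)//; apply/seteqP; split.
apply/seteqP; split=> -[y y'] /=; rewrite in_itv/= andbT.
  move=> /negP; rewrite -leNgt; have [->|yy'] := eqVneq y y'.
    by rewrite posterior_kernel_diag; left.
  by move=> /(posterior_kernel_le _ yy') h; right; split=> //; exact/eqP.
case=> [[dy r1]|[ndy h]]; apply/negP; rewrite -leNgt.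
  by rewrite (dy : y = y') posterior_kernel_diag.
by apply/posterior_kernel_le => //; exact/eqP.
Qed.

Lemma posterior_kernel_similarity : standard_borel R Ysp ->
  similarity_kernel (posterior_kernel K kappa).
Proof.
move=> hY; split.
- exact: measurable_posterior_kernel.
- exact: posterior_kernel_bounds.
- exact: posterior_kernel_sym.
- exact: posterior_kernel_diag.
Qed.

(** Admissibility says that the event [U] is null; its slice over [(y, y')] is
null exactly when [L y y'] bounds the posterior kernel there. *)
Lemma admissibleP (d : measure_display) (T : measurableType d)
    (P : probability T R) (X : {RV P >-> Omega}) (Y : {RV P >-> Ysp})
    (L : Ysp -> Ysp -> R) :
  regular_conditional_law X Y kappa -> similarity_kernel L ->
  admissible (joint_law X Y) K L <->
  ae_le (distribution P Y) (posterior_kernel K kappa) L.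
Proof.
move=> hk hL; have [mL _ _ L1] := hL.
pose U : set ((Omega * Ysp) * (Omega * Ysp)) :=
  [set z | L z.1.2 z.2.2 < K z.1.1 z.2.1].
have mU : measurable U.
  have mLz : measurable_fun setT
      (fun z : (Omega * Ysp) * (Omega * Ysp) => L z.1.2 z.2.2).
    have mz : measurable_fun setT
        (fun z : (Omega * Ysp) * (Omega * Ysp) => (z.1.2, z.2.2)).
      by apply: measurable_fun_pair; exact: measurableT_comp.
    exact: (measurableT_comp mL mz).
  have mKz : measurable_fun setT
      (fun z : (Omega * Ysp) * (Omega * Ysp) => K z.1.1 z.2.1).
    have mz : measurable_fun setT
        (fun z : (Omega * Ysp) * (Omega * Ysp) => (z.1.1, z.2.1)).
      by apply: measurable_fun_pair; exact: measurableT_comp.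
    exact: (measurableT_comp mK mz).
  have mLK := measurable_fun_ltr mLz mKz.
  by have := mLK measurableT [set true] I; rewrite setTI.
have UE p : fibre_law2 kappa p U = 0%E <->
    posterior_kernel K kappa p.1 p.2 <= L p.1 p.2.
  case: p => y y' /=; have [<-|yy'] := eqVneq y y'.
    rewrite posterior_kernel_diag L1 lexx; split=> // _.
    rewrite -(measure0 (fibre_law2 kappa (y, y))); congr (_ _).
    apply/seteqP; split=> // q; rewrite /slice2 /U /= L1 ltNge.
    by case: hK => _ /(_ q.1 q.2)/andP[_ ->].
  by rewrite posterior_kernel_le.
have muU : (\forall z \ae (joint_law X Y \x joint_law X Y)%E,
      K z.1.1 z.2.1 <= L z.1.2 z.2.2) <->
    (joint_law X Y \x joint_law X Y)%E U = 0%E.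
  rewrite -negligibleP//.
  rewrite (_ : U = ~` [set z | K z.1.1 z.2.1 <= L z.1.2 z.2.2])//.
  by apply/seteqP; split=> z /=; rewrite /U/= ltNge => /negP.
split=> [[_ /muU/(joint_law2_null hk mU)]|h]; last split=> //.
  by apply: filterS => p /UE.
by apply/muU/(joint_law2_null hk mU); apply: filterS h => p /UE.
Qed.
End posterior_kernel_theory.

Theorem proposition3p3 (R : realType) (d d1 d2 : measure_display)
    (T : measurableType d) (Omega : measurableType d1) (Ysp : measurableType d2)
    (hOmega : standard_borel R Omega) (hY : standard_borel R Ysp)
    (K : Omega -> Omega -> R) (hK : similarity_kernel K)
    (P : probability T R) (X : {RV P >-> Omega}) (Y : {RV P >-> Ysp}) :
  (exists kappa : R.-pker Ysp ~> Omega, regular_conditional_law X Y kappa) /\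
  forall kappa : R.-pker Ysp ~> Omega, regular_conditional_law X Y kappa ->
    (exists L : Ysp -> Ysp -> R,
       posterior_version (distribution P Y) K kappa L) /\
    forall L : Ysp -> Ysp -> R,
      posterior_version (distribution P Y) K kappa L ->
      [/\ admissible (joint_law X Y) K L,
          (forall L' : Ysp -> Ysp -> R, admissible (joint_law X Y) K L' ->
             ae_le (distribution P Y) L L'),
          minimal_admissible (joint_law X Y) (distribution P Y) K L
        & forall M : Ysp -> Ysp -> R,
            minimal_admissible (joint_law X Y) (distribution P Y) K M ->
            ae_equal (distribution P Y) M L].
Proof.
split; first exact: regular_conditional_law_exists.
move=> kappa hk; split.
  exists (posterior_kernel K kappa); split; last exact: aeW.
  exact: posterior_kernel_similarity.
move=> L [sL Leq].
have aL : admissible (joint_law X Y) K L.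
  by apply/(admissibleP hK hk sL); apply: filterS Leq => p ->.
have minL L' : admissible (joint_law X Y) K L' -> ae_le (distribution P Y) L L'.
  move=> /[dup] -[sL' _] /(admissibleP hK hk sL').
  by apply: filterS2 Leq => p ->.
split=> // M [aM minM].
by apply: filterS2 (minM _ aL) (minL _ aM) => p ML LM; apply/le_anti/andP.
Qed.
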